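(* Let $\mathbb{F}$ be any field. There is, up to isomorphism, a unique nilpotent symplectic alternating algebra $L$ over $\mathbb{F}$ of dimension $10$ with isotropic center of dimension $4$ where $L^3=Z(L)$ and $L$ is of type $B$. This algebra can be given by the presentation $$\mathcal{P}_{10}^{(4,3)}:\quad (x_1y_2,y_3)=1,\ (y_1y_2,y_4)=1,\ (y_1y_3,y_5)=1.$$
   Context: A symplectic alternating algebra (SAA) over a field $\mathbb{F}$ is a finite-dimensional vector space $L$ over $\mathbb{F}$ with a non-degenerate alternating bilinear form $(\ ,\ )$ and a bilinear product $\cdot$ satisfying $u\cdot u=0$ for all $u$ and $(u\cdot v,w)=(v\cdot w,u)$ for all $u,v,w\in L$. No associativity or Jacobi identity is assumed. The map $(u,v,w)\mapsto(uv,w)$ is then an alternating trilinear form. A standard basis (in dimension $10$) is a basis $x_1,y_1,\ldots,x_5,y_5$ with $(x_i,x_j)=(y_i,y_j)=0$ and $(x_i,y_j)=\delta_{ij}$ for all $i,j$. Presentations: $L$ is given by a presentation if there is a standard basis for which the listed values of triples $(uv,w)$ hold and $(uv,w)=0$ for all triples of basis elements that are not a reordering of a listed one. Isomorphisms are linear bijections preserving product and form. $L^1=L$, $L^{m+1}=L^mL$ (span of products). $L$ is nilpotent if $L^{m+1}=\{0\}$ for some $m\ge 0$. The center is $Z(L)=\{x\in L: xL=\{0\}\}$; it is isotropic if $(u,v)=0$ for all $u,v\in Z(L)$. Type $B$: let $L$ be nilpotent of dimension $10$ with isotropic center of dimension $4$ and $L^3=Z(L)$. Then $L^2=Z(L)^{\perp}$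 is abelian of dimension $6$, so $L^2/Z(L)$ has dimension $2$ and $L/L^2$ has dimension $4$. For each $\bar z=z+Z(L)\in L^2/Z(L)$ there is a well-defined alternating form $\phi_{\bar z}:L/L^2\times L/L^2\to\mathbb{F}$, $\phi_{\bar z}(u+L^2,v+L^2)=(zu,v)$. $L$ is of type $B$ if there exists $0\neq\bar z\in L^2/Z(L)$ such that $\phi_{\bar z}$ is degenerate but $\phi_{\bar t}$ is non-degenerate for all $\bar t\in L^2/Z(L)$ not in $\mathbb{F}\bar z$. *)

(* Defs.v *)
From HB Require Import structures.
From mathcomp Require Import all_boot all_order all_algebra.

Set Implicit Arguments.
Unset Strict Implicit.
Unset Printing Implicit Defensive.

Import GRing.Theory.
Local Open Scope ring_scope.

Record saa (F : fieldType) := SAA {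
  saa_vect :> vectType F;
  saa_mul : {bilinear saa_vect -> saa_vect -> saa_vect};
  saa_form : {biscalar saa_vect};
  saa_form_alt : forall u, saa_form u u = 0;
  saa_form_nondeg : forall u, (forall v, saa_form u v = 0) -> u = 0;
  saa_mul_alt : forall u, saa_mul u u = 0;
  saa_form_mul : forall u v w,
    saa_form (saa_mul u v) w = saa_form (saa_mul v w) u
}.

Declare Scope saa_scope.
Delimit Scope saa_scope with SAA.
Local Open Scope saa_scope.
Notation "u '·' v" := (saa_mul _ u v)
  (at level 40, left associativity) : saa_scope.
Notation "⟨ u , v ⟩" := (saa_form _ u v)
  (at level 0, u at level 99, v at level 99) : saa_scope.

Definition saa_isomorphic (F : fieldType) (L M : saa F) : Prop :=
  exists f : {linear L -> M},
    [/\ bijective f,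
        forall u v, f (u · v) = f u · f v
      & forall u v, ⟨f u, f v⟩ = ⟨u, v⟩].

Section Structure.
Variables (F : fieldType) (L : saa F).
Implicit Types (u v w z t : L) (U V W : {vspace L}) (m : nat).

(* The span of products of basis vectors; by prod_vspaceP this is the span of
   all u · v with u \in U and v \in V. *)
Definition prod_vspace U V : {vspace L} :=
  <<[seq u · v | u <- vbasis U, v <- vbasis V]>>%VS.

Lemma memv_prod_vspace U V u v :
  u \in U -> v \in V -> u · v \in prod_vspace U V.
Proof.
move=> /coord_vbasis-> /coord_vbasis->; rewrite linear_sumlz.
apply: memv_suml => i _; rewrite linear_sumr; apply: memv_suml => j _.
rewrite linearZl linearZr !memvZ // memv_span //.
by apply: allpairs_f; rewrite mem_nth ?size_tuple.
Qed.

Lemma prod_vspaceP U V W :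
  reflect (forall u v, u \in U -> v \in V -> u · v \in W)
          (prod_vspace U V <= W)%VS.
Proof.
apply: (iffP idP) => [sUVW u v Uu Vv | sUVW].
  by apply: (subvP sUVW); apply: memv_prod_vspace.
apply/span_subvP=> _ /allpairsP[[u v] /= [Uu Vv ->]].
by apply: sUVW; apply: vbasis_mem.
Qed.

(* saa_pow m is L^m for m >= 1; saa_pow 0 = saa_pow 1 is a junk value. *)
Definition saa_pow m : {vspace L} :=
  iter m.-1 (fun U => prod_vspace U fullv) fullv.

Definition saa_nilpotent : Prop := exists m, saa_pow m.+1 = 0%VS.

(* The kernel of x |-> (y |-> x · y); see mem_center. *)
Definition saa_center : {vspace L} :=
  lker (linfun (fun u => linfun (saa_mul L u) : 'Hom(L, L))).

Lemma mem_center u : reflect (forall v, u · v = 0) (u \in saa_center).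
Proof.
pose h u := linfun (saa_mul L u).
have h_lin : linear h.
  move=> a x y; apply/lfunP=> v.
  by rewrite add_lfunE scale_lfunE !lfunE /= linearPl.
pose hM := GRing.isLinear.Build _ _ _ _ h h_lin.
pose hL : {linear L -> 'Hom(L, L)} := HB.pack h hM.
rewrite memv_ker (lfunE hL) /= /h.
apply: (iffP eqP) => [h0 v | u0].
  by have /lfunP/(_ v) := h0; rewrite zero_lfunE lfunE.
by apply/lfunP=> v; rewrite zero_lfunE lfunE /= u0.
Qed.

Definition saa_isotropic U : Prop :=
  forall u v, u \in U -> v \in U -> ⟨u, v⟩ = 0.

(* For z in L^2, the form induced by (u, v) |-> (zu, v) on L/L^2, written on
   representatives; saa_phi_wd shows that it only depends on the classes of z
   modulo Z(L) and of u, v modulo L^2. *)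
Definition saa_phi z u v : F := ⟨z · u, v⟩.

Lemma saa_phi_wd z z' u u' v v' :
    saa_pow 3 = saa_center -> z \in saa_pow 2 ->
    z - z' \in saa_center -> u - u' \in saa_pow 2 -> v - v' \in saa_pow 2 ->
  saa_phi z u v = saa_phi z' u' v'.
Proof.
move=> L3Z L2z Zz L2u L2v.
have L2L x y : x \in saa_pow 2 -> x · y \in saa_center.
  by move=> L2x; rewrite -L3Z; apply: memv_prod_vspace; rewrite ?memvf.
have mulC x y : x · y = - (y · x).
  apply/eqP; rewrite -addr_eq0; apply/eqP.
  have := saa_mul_alt (x + y).
  by rewrite linearDl !linearDr !saa_mul_alt add0r addr0.
have formC x y : ⟨x, y⟩ = - ⟨y, x⟩.
  apply/eqP; rewrite -addr_eq0; apply/eqP.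
  have := saa_form_alt (x + y).
  by rewrite linearDl !linearDr /= !saa_form_alt add0r addr0.
have L2Z x c : x \in saa_pow 2 -> c \in saa_center -> ⟨c, x⟩ = 0.
  move=> L2x /mem_center Zc.
  suff /subvP/(_ _ L2x) :
      (saa_pow 2 <= lker (linfun (saa_form L c : L -> F^o)))%VS.
    by rewrite memv_ker lfunE => /eqP.
  apply/prod_vspaceP=> a b _ _; rewrite memv_ker lfunE /=.
  by rewrite formC saa_form_mul mulC Zc oppr0 linear0l oppr0.
rewrite /saa_phi.
have -> : ⟨z · u, v⟩ = ⟨z · u, v'⟩.
  by apply/eqP; rewrite -subr_eq0 -linearBr L2Z // L2L.
have -> : ⟨z · u, v'⟩ = ⟨z · u', v'⟩.
  apply/eqP; rewrite -subr_eq0 -linearBl -linearBr.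
  by rewrite saa_form_mul L2Z // L2L.
apply/eqP; rewrite -subr_eq0 -linearBl -linearBl.
by move/mem_center: Zz => ->; rewrite linear0l.
Qed.

(* Degeneracy of the form induced by saa_phi z on L/L^2: some nonzero class
   u + L^2 is orthogonal to every class. *)
Definition saa_phi_degenerate z : Prop :=
  exists2 u, u \notin saa_pow 2 & forall v, saa_phi z u v = 0.

(* z and t represent classes in L^2/Z(L): the class of z is nonzero iff
   z \notin Z(L), and that of t lies outside the line F(z + Z(L)) iff
   t \notin Z(L) + F z. *)
Definition saa_typeB : Prop :=
  exists z, [/\ z \in saa_pow 2, z \notin saa_center, saa_phi_degenerate z
    & forall t, t \in saa_pow 2 -> t \notin (saa_center + <[z]>)%VS ->
        ~ saa_phi_degenerate t].

(* Indices of a standard basis in dimension 2n: inl i for x_i, inr i for y_i. *)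
Definition gen n : finType := ('I_n + 'I_n)%type.

Definition standard_basis n (e : gen n -> L) : Prop :=
  [/\ basis_of fullv (codom e),
      forall i j, ⟨e (inl i), e (inl j)⟩ = 0,
      forall i j, ⟨e (inr i), e (inr j)⟩ = 0
    & forall i j, ⟨e (inl i), e (inr j)⟩ = (i == j)%:R].

(* An entry (a, b, c, r) of P stands for the relation (ab, c) = r. *)
Definition has_presentation n (P : seq (gen n * gen n * gen n * F)) : Prop :=
  exists2 e : gen n -> L, standard_basis e &
    (forall a b c r, (a, b, c, r) \in P -> ⟨e a · e b, e c⟩ = r) /\
    (forall a b c,
      (forall a' b' c' r, (a', b', c', r) \in P ->
        ~~ perm_eq [:: a; b; c] [:: a'; b'; c']) ->
      ⟨e a · e b, e c⟩ = 0).

End Structure.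

Notation "''x_' k" := (inl (@Ordinal 5 k%N.-1 isT) : gen 5)
  (at level 8, k at level 2, only parsing) : saa_scope.
Notation "''y_' k" := (inr (@Ordinal 5 k%N.-1 isT) : gen 5)
  (at level 8, k at level 2, only parsing) : saa_scope.

Definition P10_4_3 (F : fieldType) : seq (gen 5 * gen 5 * gen 5 * F) :=
  [:: ('x_1, 'y_2, 'y_3, 1); ('y_1, 'y_2, 'y_4, 1); ('y_1, 'y_3, 'y_5, 1)].

Definition nilpotent_10_4_3_typeB (F : fieldType) (L : saa F) : Prop :=
  [/\ saa_nilpotent L /\ \dim {:L} = 10%N,
      saa_isotropic (saa_center L),
      \dim (saa_center L) = 4%N,
      saa_pow L 3 = saa_center L
    & saa_typeB L].

(* Main.v *)
From HB Require Import structures.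
Require Import Defs.
From mathcomp Require Import all_boot all_order all_algebra.
From mathcomp Require Import ring.

(** Existence.  An alternating trilinear form on a symplectic space is the same
    thing as a symplectic alternating algebra: nondegeneracy turns the linear
    form T(u, v, _) into the vector u · v.  A presentation prescribes T as a sum
    of 3 x 3 minors of coordinates ([triform]), so the presented algebra
    [model] exists for every presentation.  For P10_4_3 its powers and its center
    are spans of basis vectors, and type B is read off the coordinates
    ([model_nilpotent_typeB], with the class of x_1 as degenerate class).

    Uniqueness.  Two algebras with standard bases on which the triples (uv, w)
    agree are isomorphic ([standard_basis_isomorphic]), so it is enough to find
    in any M of type B a standard basis with the prescribed triples
    ([typeB_standard_basis]).  Here M^2 is the orthogonal of Z = Z(M), is abelian
    and has dimension 6.  For z in M^2 let phi_z be the alternating form (zu, v)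
    on the 4-dimensional space M/M^2.

    - Let z span the degenerate class and t in M^2 satisfy (z, t) = 1.  As
      phi_z is nonzero and degenerate, it has rank 2; let R be its radical.
    - The Pfaffian of phi_(t - kz) is affine in k since that of phi_z vanishes;
      the forms being nondegenerate for all k, it is constant, which
      says that phi_t vanishes on R.  Concretely, were phi_t nonzero on R, some
      t - kz would kill a vector outside M^2 ([adapted_frame]).
    - Hence phi_t puts R in duality with a complement of R: there are dual bases
      y_4, y_5 of R and y_2, y_3 of the complement, on which phi_z and phi_t take
      the prescribed values after rescaling z and t and shifting y_2 by R.
    - The four remaining triples (y_i y_j, y_k) are killed one by one by adding
      multiples of t to the y_i ([reduced_frame]); then corrections in Z, which
      do not change products, make the frame orthogonal ([orthogonal_frame]);
      the duals of the y_i in Z complete the basis. *)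

Set Implicit Arguments.
Unset Strict Implicit.
Unset Printing Implicit Defensive.

Import GRing.Theory.
Local Open Scope ring_scope.
Local Open Scope saa_scope.

(** * Calculus of the product and the form *)

Section Calculus.
Variables (F : fieldType) (L : saa F).
Implicit Types (u v w : L) (a : F) (U : {vspace L}).

Lemma formDl u v w : ⟨u + v, w⟩ = ⟨u, w⟩ + ⟨v, w⟩. Proof. exact: linearDl. Qed.
Lemma formDr u v w : ⟨u, v + w⟩ = ⟨u, v⟩ + ⟨u, w⟩. Proof. exact: linearDr. Qed.
Lemma formNl u v : ⟨- u, v⟩ = - ⟨u, v⟩. Proof. exact: linearNl. Qed.
Lemma formNr u v : ⟨u, - v⟩ = - ⟨u, v⟩. Proof. exact: linearNr. Qed.
Lemma formZl a u v : ⟨a *: u, v⟩ = a * ⟨u, v⟩. Proof. exact: linearZl_LR. Qed.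
Lemma formZr a u v : ⟨u, a *: v⟩ = a * ⟨u, v⟩. Proof. exact: linearZr_LR. Qed.
Lemma form0l u : ⟨0, u⟩ = 0. Proof. exact: linear0l. Qed.
Definition formE := (formDl, formDr, formNl, formNr, formZl, formZr).

Lemma prodDl u v w : (u + v) · w = u · w + v · w. Proof. exact: linearDl. Qed.
Lemma prodDr u v w : u · (v + w) = u · v + u · w. Proof. exact: linearDr. Qed.
Lemma prodNl u v : (- u) · v = - (u · v). Proof. exact: linearNl. Qed.
Lemma prodNr u v : u · (- v) = - (u · v). Proof. exact: linearNr. Qed.
Lemma prodZl a u v : (a *: u) · v = a *: (u · v). Proof. exact: linearZl_LR. Qed.
Lemma prodZr a u v : u · (a *: v) = a *: (u · v). Proof. exact: linearZr_LR. Qed.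
Definition prodE := (prodDl, prodDr, prodNl, prodNr, prodZl, prodZr).

Lemma form_sumr I (r : seq I) (P : pred I) u (v : I -> L) :
  ⟨u, \sum_(i <- r | P i) v i⟩ = \sum_(i <- r | P i) ⟨u, v i⟩.
Proof. exact: linear_sumr. Qed.

Lemma form_suml I (r : seq I) (P : pred I) (u : I -> L) v :
  ⟨\sum_(i <- r | P i) u i, v⟩ = \sum_(i <- r | P i) ⟨u i, v⟩.
Proof. exact: linear_sumlz. Qed.

Lemma prod_sumr I (r : seq I) (P : pred I) u (v : I -> L) :
  u · (\sum_(i <- r | P i) v i) = \sum_(i <- r | P i) u · v i.
Proof. exact: linear_sumr. Qed.

Lemma prod_suml I (r : seq I) (P : pred I) (u : I -> L) v :
  (\sum_(i <- r | P i) u i) · v = \sum_(i <- r | P i) u i · v.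
Proof. exact: linear_sumlz. Qed.

Lemma form_swap u v : ⟨u, v⟩ = - ⟨v, u⟩.
Proof.
apply/eqP; rewrite -addr_eq0; apply/eqP.
by have := saa_form_alt (u + v); rewrite !formE !saa_form_alt add0r addr0.
Qed.

Lemma prod_swap u v : u · v = - (v · u).
Proof.
apply/eqP; rewrite -addr_eq0; apply/eqP.
by have := saa_mul_alt (u + v); rewrite !prodE !saa_mul_alt add0r addr0.
Qed.

Lemma triple_rot u v w : ⟨u · v, w⟩ = ⟨v · w, u⟩.
Proof. exact: saa_form_mul. Qed.

Lemma triple_swap u v w : ⟨u · v, w⟩ = - ⟨v · u, w⟩.
Proof. by rewrite prod_swap formNl. Qed.

Lemma form_inj u v : (forall w, ⟨u, w⟩ = ⟨v, w⟩) -> u = v.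
Proof.
move=> uv; apply/eqP; rewrite -subr_eq0; apply/eqP.
by apply: saa_form_nondeg => w; rewrite !formE uv subrr.
Qed.

Lemma triple_swapr u v w : ⟨u · v, w⟩ = - ⟨u · w, v⟩.
Proof. by rewrite triple_rot triple_swap triple_rot triple_rot. Qed.

Lemma triple_altr u v : ⟨u · v, v⟩ = 0.
Proof. by rewrite triple_rot saa_mul_alt form0l. Qed.

Lemma triple_altl u v : ⟨u · v, u⟩ = 0.
Proof. by rewrite -triple_rot saa_mul_alt form0l. Qed.

(** Only the linear terms survive: two arguments equal to multiples of t give 0.
    This is what allows the triples of a frame to be corrected independently. *)
Lemma triple_shift t a b c u v w :
  ⟨(u + a *: t) · (v + b *: t), w + c *: t⟩ =
  ⟨u · v, w⟩ + a * ⟨t · v, w⟩ - b * ⟨t · u, w⟩ + c * ⟨t · u, v⟩.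
Proof.
rewrite !(prodE, formE) saa_mul_alt !triple_altl triple_altr !form0l.
rewrite (triple_swap u t) -(triple_rot t u v); ring.
Qed.

(** (uv, w) = (vw, u), so u kills everything exactly when it is orthogonal to all
    products. *)
Lemma center_orthogonal u :
  u \in saa_center L <-> forall v, v \in saa_pow L 2 -> ⟨u, v⟩ = 0.
Proof.
split=> [/mem_center u0 | u0].
  suff /subvP L2u : (saa_pow L 2 <= lker (linfun (saa_form L u : L -> F^o)))%VS.
    by move=> v /L2u; rewrite memv_ker lfunE => /eqP.
  apply/prod_vspaceP => a b _ _; rewrite memv_ker lfunE /=.
  by rewrite form_swap -triple_rot u0 form0l oppr0.
apply/mem_center => v; apply: saa_form_nondeg => w.
by rewrite triple_rot form_swap u0 ?oppr0 // memv_prod_vspace ?memvf.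
Qed.

Lemma form_eq0_upper n (v : 'I_n -> L) :
  (forall i j : 'I_n, (i < j)%N -> ⟨v i, v j⟩ = 0) -> forall i j, ⟨v i, v j⟩ = 0.
Proof.
move=> up i j; case: (ltngtP i j) => [|ji|/val_inj->]; first exact: up.
  by rewrite form_swap up ?oppr0.
exact: saa_form_alt.
Qed.

Lemma saa_powS m : saa_pow L m.+2 = prod_vspace (saa_pow L m.+1) fullv.
Proof. by []. Qed.

End Calculus.

(** * Standard bases and isomorphisms *)

Section StandardBasis.
Variables (F : fieldType) (n : nat).
Implicit Types (L M : saa F) (a b c : gen n).

(** With these vectors, u |-> ⟨u, dual e a⟩ is the coordinate of u at e a. *)
Definition dual L (e : gen n -> L) a : L :=
  match a with inl i => e (inr i) | inr i => - e (inl i) end.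

Lemma form_dual L (e : gen n -> L) :
    (forall i j, ⟨e (inl i), e (inl j)⟩ = 0) ->
    (forall i j, ⟨e (inr i), e (inr j)⟩ = 0) ->
    (forall i j, ⟨e (inl i), e (inr j)⟩ = (i == j)%:R) ->
  forall a b, ⟨e a, dual e b⟩ = (a == b)%:R.
Proof.
move=> xx yy xy [i|i] [j|j] /=; rewrite ?formNr ?xx ?yy ?xy ?oppr0 //.
by rewrite -form_swap xy eq_sym.
Qed.

(** The Gram relations already force linear independence, so that counting
    dimensions gives the spanning property. *)
Lemma standard_basisP L (e : gen n -> L) :
    \dim {:L} = (n + n)%N ->
    (forall i j, ⟨e (inl i), e (inl j)⟩ = 0) ->
    (forall i j, ⟨e (inr i), e (inr j)⟩ = 0) ->
    (forall i j, ⟨e (inl i), e (inr j)⟩ = (i == j)%:R) ->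
  standard_basis e.
Proof.
move=> dimL xx yy xy; split=> //.
have sz : size (codom e) = (n + n)%N.
  by rewrite size_codom card_sum card_ord.
rewrite basisEfree subvf sz dimL leqnn !andbT.
rewrite -[codom e]/(tval (codom_tuple e)); apply/freeP => k e0 i.
pose a := enum_val i.
have nth_e (j : 'I_#|gen n|) : (codom_tuple e)`_j = e (enum_val j).
  by rewrite -tnth_nth tnth_map /tnth -enum_val_nth.
have := congr1 (fun u => ⟨u, dual e a⟩) e0; rewrite form0l form_suml.
rewrite (bigD1 i) //= big1 => [|j ij]; last first.
  rewrite formZl nth_e form_dual // (inj_eq enum_val_inj) (negPf ij).
  by rewrite mulr0.
by rewrite formZl nth_e form_dual // eqxx mulr1 addr0.
Qed.

Lemma standard_expand L (e : gen n -> L) u :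
  standard_basis e -> u = \sum_a ⟨u, dual e a⟩ *: e a.
Proof.
move=> [Be xx yy xy]; pose w := u - \sum_a ⟨u, dual e a⟩ *: e a.
apply/eqP; rewrite -subr_eq0 -/w; apply/eqP.
have w_dual a : ⟨w, dual e a⟩ = 0.
  rewrite !formE form_suml (bigD1 a) //= big1 => [|b /negPf ba].
    by rewrite formZl form_dual // eqxx mulr1 addr0 subrr.
  by rewrite formZl form_dual // ba mulr0.
have w_e a : ⟨w, e a⟩ = 0.
  case: a => i; last exact: (w_dual (inl i)).
  by have := w_dual (inr i); rewrite /= formNr => /eqP; rewrite oppr_eq0 => /eqP.
apply: saa_form_nondeg => v.
suff /subvP/(_ v (memvf v)) : (fullv <= lker (linfun (saa_form L w : L -> F^o)))%VS.
  by rewrite memv_ker lfunE => /eqP.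
rewrite -(span_basis Be); apply/span_subvP => _ /codomP[a ->].
by rewrite memv_ker lfunE /= w_e.
Qed.

Lemma triple_expand L (e : gen n -> L) u v w : standard_basis e ->
  ⟨u · v, w⟩ = \sum_a \sum_b \sum_c
    ⟨u, dual e a⟩ * ⟨v, dual e b⟩ * ⟨w, dual e c⟩ * ⟨e a · e b, e c⟩.
Proof.
move=> Se; rewrite {1}(standard_expand u Se) {1}(standard_expand v Se).
rewrite {1}(standard_expand w Se) prod_suml form_suml.
apply: eq_bigr => a _; rewrite prod_sumr form_suml; apply: eq_bigr => b _.
rewrite form_sumr; apply: eq_bigr => c _.
by rewrite !prodE !formE; ring.
Qed.

(** The linear map e a |-> e' a preserves coordinates, hence the form and
    the triples; the product is determined by the triples, by nondegeneracy. *)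
Lemma standard_basis_isomorphic L M (e : gen n -> L) (e' : gen n -> M) :
    standard_basis e -> standard_basis e' ->
    (forall a b c, ⟨e a · e b, e c⟩ = ⟨e' a · e' b, e' c⟩) ->
  saa_isomorphic L M.
Proof.
move=> Se Se' ee'.
have [[Be xx yy xy] [Be' xx' yy' xy']] := (Se, Se').
pose f0 u := \sum_a ⟨u, dual e a⟩ *: e' a.
pose g0 u := \sum_a ⟨u, dual e' a⟩ *: e a.
have f_lin : linear f0.
  move=> k u v; rewrite /f0 scaler_sumr -big_split /=; apply: eq_bigr => a _.
  by rewrite !formE scalerDl scalerA.
pose f : {linear L -> M} := HB.pack f0 (GRing.isLinear.Build _ _ _ _ f0 f_lin).
have fE u : f u = \sum_a ⟨u, dual e a⟩ *: e' a by [].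
have f_dual u a : ⟨f u, dual e' a⟩ = ⟨u, dual e a⟩.
  rewrite fE form_suml (bigD1 a) //= big1 => [|b /negPf ba].
    by rewrite formZl form_dual // eqxx mulr1 addr0.
  by rewrite formZl form_dual // ba mulr0.
have g_dual u a : ⟨g0 u, dual e a⟩ = ⟨u, dual e' a⟩.
  rewrite /g0 form_suml (bigD1 a) //= big1 => [|b /negPf ba].
    by rewrite formZl form_dual // eqxx mulr1 addr0.
  by rewrite formZl form_dual // ba mulr0.
have fK : cancel f g0.
  move=> u; rewrite [RHS](standard_expand _ Se); apply: eq_bigr => a _.
  by rewrite f_dual.
have gK : cancel g0 f.
  move=> u; rewrite [RHS](standard_expand _ Se') fE; apply: eq_bigr => a _.
  by rewrite g_dual.
have f_form u v : ⟨f u, f v⟩ = ⟨u, v⟩.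
  rewrite [in RHS](standard_expand v Se) (fE v) !form_sumr.
  apply: eq_bigr => a _; rewrite !formZr; congr (_ * _).
  case: a => i; last exact: (f_dual u (inl i)).
  have /= := f_dual u (inr i); rewrite !formNr; exact: oppr_inj.
exists f; split; [by exists g0 | move=> u v | exact: f_form].
apply: form_inj => w; rewrite -[w]gK f_form; set z := g0 w.
rewrite (triple_expand _ _ _ Se) (triple_expand _ _ _ Se'); apply: eq_bigr => a _.
apply: eq_bigr => b _; apply: eq_bigr => c _; by rewrite !f_dual ee'.
Qed.

End StandardBasis.

(** * The algebra with a prescribed presentation *)

Section Model.
Variables (F : fieldType) (n : nat) (P : seq (gen n * gen n * gen n * F)).
Implicit Types (a b c : gen n) (f g h : gen n -> F).

Definition minor3 a b c f g h : F :=
  f a * (g b * h c - g c * h b) + f b * (g c * h a - g a * h c)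
  + f c * (g a * h b - g b * h a).

Definition triform f g h : F :=
  \sum_(p <- P) p.2 * minor3 p.1.1.1 p.1.1.2 p.1.2 f g h.

Lemma triform_lin k f f' g h :
  triform (fun a => k * f a + f' a) g h = k * triform f g h + triform f' g h.
Proof.
rewrite /triform mulr_sumr -big_split /=; apply: eq_bigr => p _.
by rewrite /minor3; ring.
Qed.

Lemma triform_rot f g h : triform f g h = triform g h f.
Proof. by apply: eq_bigr => p _; rewrite /minor3; ring. Qed.

Lemma triform_alt f h : triform f f h = 0.
Proof. by rewrite /triform big1 // => p _; rewrite /minor3; ring. Qed.

Lemma triform_swap f g h : triform f g h = - triform g f h.
Proof.
rewrite /triform -sumrN; apply: eq_bigr => p _; rewrite /minor3; ring.
Qed.

Lemma eq_triform f f' g g' h h' :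
  f =1 f' -> g =1 g' -> h =1 h' -> triform f g h = triform f' g' h'.
Proof.
move=> ff gg hh; apply: eq_bigr => p _.
by rewrite /minor3 !ff !gg !hh.
Qed.

Definition delta a : gen n -> F := fun b => (b == a)%:R.

Lemma triform_expand f g h : triform f g h = \sum_a h a * triform f g (delta a).
Proof.
have sumE (k : gen n -> F) c : \sum_a k a * delta a c = k c.
  rewrite (bigD1 c) //= big1 => [|a /negPf ac]; rewrite /delta.
    by rewrite eqxx mulr1 addr0.
  by rewrite eq_sym ac mulr0.
under eq_bigr => a _ do rewrite /triform mulr_sumr.
rewrite exchange_big /=; apply: eq_bigr => p _.
set a := p.1.1.1; set b := p.1.1.2; set c := p.1.2.
rewrite /minor3 -(sumE h a) -(sumE h b) -(sumE h c).
rewrite !(mulr_suml, mulr_sumr) -!sumrB !(mulr_suml, mulr_sumr) -!big_split /= mulr_sumr.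
by apply: eq_bigr => x _; ring.
Qed.

(** The coordinates of the vectors [dual] of the basis of indicator functions. *)
Definition cdual a : gen n -> F :=
  match a with inl i => delta (inr i) | inr i => fun b => - delta (inl i) b end.

(** The values lie in F^o, F seen as a module over itself, for the space of
    functions to be a vector space. *)
Definition model_space : vectType F := {ffun gen n -> F^o}.
Implicit Types u v w : model_space.

Definition coef u : gen n -> F := fun a => (u : {ffun gen n -> F^o}) a.

Definition model_mul u v : model_space :=
  [ffun a => triform (coef u) (coef v) (cdual a)].

Definition model_form u v : F :=
  \sum_i (coef u (inl i) * coef v (inr i) - coef u (inr i) * coef v (inl i)).

Lemma coefP k u v : coef (k *: u + v) =1 fun a => k * coef u a + coef v a.
Proof. by move=> a; rewrite /coef !ffunE. Qed.

Lemma model_mulC u v : model_mul u v = - model_mul v u.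
Proof.
apply/ffunP => a; rewrite !ffunE.
by rewrite /triform -sumrN; apply: eq_bigr => p _; rewrite /minor3; ring.
Qed.

Lemma model_mul_bilinear : bilinear_for
  (GRing.Scale.Law.clone _ _ *:%R _) (GRing.Scale.Law.clone _ _ *:%R _) model_mul.
Proof.
have linl w : linear (model_mul^~ w).
  move=> k u v; apply/ffunP => a; rewrite !ffunE.
  rewrite (eq_triform (coefP k u v) (frefl _) (frefl _)).
  exact: triform_lin.
split=> // u k v w.
by rewrite model_mulC linl opprD -scalerN -!model_mulC.
Qed.

Lemma model_formC u v : model_form u v = - model_form v u.
Proof. by rewrite /model_form -sumrN; apply: eq_bigr => i _; ring. Qed.

Lemma model_form_bilinear : bilinear_for
  (GRing.Scale.Law.clone _ _ *%R _) (GRing.Scale.Law.clone _ _ *%R _) model_form.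
Proof.
have linl w : scalar (model_form^~ w).
  move=> k u v; rewrite /model_form mulr_sumr -big_split /=.
  by apply: eq_bigr => i _; rewrite !coefP; ring.
split=> // u k v w.
by rewrite model_formC linl opprD -mulrN -!model_formC.
Qed.

HB.instance Definition _ := bilinear_isBilinear.Build F
  model_space model_space model_space _ _ model_mul model_mul_bilinear.
HB.instance Definition _ := bilinear_isBilinear.Build F
  model_space model_space F _ _ model_form model_form_bilinear.

Definition of_coef f : model_space := [ffun a => f a : F^o].

Lemma of_coefK f : coef (of_coef f) =1 f. Proof. by move=> a; rewrite /coef ffunE. Qed.

Lemma model_form_alt u : model_form u u = 0.
Proof. by rewrite /model_form big1 // => i _; ring. Qed.

Lemma inl_eq (i j : 'I_n) : (inl i == inl j :> gen n) = (i == j). Proof. by []. Qed.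
Lemma inr_eq (i j : 'I_n) : (inr i == inr j :> gen n) = (i == j). Proof. by []. Qed.

Lemma model_form_cdual u a : model_form u (of_coef (cdual a)) = coef u a.
Proof.
case: a => i; rewrite /model_form (bigD1 i) //= big1 ?addr0.
- by rewrite !of_coefK /delta /= eqxx /=; ring.
- by move=> j /negPf ji; rewrite !of_coefK /delta /= inr_eq ji /=; ring.
- by rewrite !of_coefK /delta /= eqxx /=; ring.
- by move=> j /negPf ji; rewrite !of_coefK /delta /= inl_eq ji /=; ring.
Qed.

Lemma model_form_nondeg u : (forall v, model_form u v = 0) -> u = 0.
Proof.
move=> u0; apply/ffunP => a; rewrite ffunE.
by have := u0 (of_coef (cdual a)); rewrite model_form_cdual.
Qed.

Lemma model_mul_alt u : model_mul u u = 0.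
Proof. by apply/ffunP => a; rewrite !ffunE triform_alt. Qed.

Lemma coef_mul u v a : coef (model_mul u v) a = triform (coef u) (coef v) (cdual a).
Proof. by rewrite /coef ffunE. Qed.

(** The product was defined coordinatewise for this identity to hold: it makes
    [triform] the trilinear form of the algebra. *)
Lemma model_triple u v w :
  model_form (model_mul u v) w = triform (coef u) (coef v) (coef w).
Proof.
rewrite triform_expand big_sumType /= addrC -big_split; apply: eq_bigr => i _.
rewrite /= !coef_mul mulrC; congr (_ + _); rewrite mulrC -mulrN; congr (_ * _).
by rewrite /triform -sumrN; apply: eq_bigr => p _; rewrite /minor3 /=; ring.
Qed.

Lemma model_form_mul u v w :
  model_form (model_mul u v) w = model_form (model_mul v w) u.
Proof. by rewrite !model_triple triform_rot. Qed.

Definition model : saa F :=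
  SAA model_form_alt model_form_nondeg model_mul_alt model_form_mul.

Definition mbasis a : model := of_coef (delta a).

Lemma dim_model : \dim {:model} = (n + n)%N.
Proof.
by rewrite dimvf /dim /= card_sum card_ord muln1.
Qed.

Lemma model_standard : standard_basis mbasis.
Proof.
have E u i : ⟨u : model, mbasis (inr i)⟩ = coef u (inl i).
  exact: (model_form_cdual u (inl i)).
have E' u i : ⟨mbasis (inl i), u : model⟩ = coef u (inr i).
  rewrite form_swap -(model_form_cdual u (inr i)) -formNr; congr (model_form _ _).
  by apply/ffunP => b; rewrite !ffunE.
apply: standard_basisP => [|i j|i j|i j]; first exact: dim_model.
- by rewrite E' of_coefK.
- by rewrite E of_coefK.
- by rewrite E of_coefK /delta !eqE /= eq_sym.
Qed.

Lemma mbasis_triple a b c :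
  ⟨mbasis a · mbasis b, mbasis c⟩ = triform (delta a) (delta b) (delta c).
Proof. by rewrite [LHS]model_triple; apply: eq_triform => x; rewrite of_coefK. Qed.

(** A monomial of the minor is nonzero at the indicators of a, b, c only if a, b, c
    is the corresponding rearrangement of a', b', c'. *)
Lemma minor3_delta_eq0 a b c a' b' c' :
  ~~ perm_eq [:: a; b; c] [:: a'; b'; c'] ->
  minor3 a' b' c' (delta a) (delta b) (delta c) = 0.
Proof.
move=> nperm.
have E x y z : perm_eq [:: x; y; z] [:: a'; b'; c'] ->
    (x == a)%:R * ((y == b)%:R * (z == c)%:R) = 0 :> F.
  case: eqP => [->|_] Ep; last by rewrite mul0r.
  case: eqP Ep => [->|_] Ep; last by rewrite mul0r mulr0.
  case: eqP Ep => [->|_] Ep; last by rewrite !mulr0.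
  by rewrite Ep in nperm.
have S (l : seq (gen n)) : (forall p, count p l = count p [:: a'; b'; c']) ->
    perm_eq l [:: a'; b'; c'] by move/permP.
rewrite /minor3 /delta !mulrBr !E ?subrr ?addr0 //.
all: by apply: S => p /=; ring.
Qed.

End Model.

(** * Coordinate subspaces of that algebra *)

Section CoordinateSubspaces.
Variables (F : fieldType) (n : nat) (P : seq (gen n * gen n * gen n * F)).
Notation L := (model P).
Implicit Types (u : L) (a b c : gen n) (s : seq (gen n)).

Definition cspan s : {vspace L} := <<map (mbasis P) s>>%VS.

Lemma coef_expand u : u = \sum_a coef u a *: mbasis P a.
Proof.
apply/ffunP => b; rewrite sum_ffunE (bigD1 b) //= big1 => [|a /negPf ab].
  by rewrite !ffunE /delta eqxx addr0 /coef [LHS](esym (mulr1 _)).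
by rewrite !ffunE /delta eq_sym ab [LHS]mulr0.
Qed.

Lemma mem_cspan s u : reflect (forall a, a \notin s -> coef u a = 0) (u \in cspan s).
Proof.
apply: (iffP idP) => [us a as_ | u0].
  have f_lin : scalar (fun v : L => coef v a) by move=> k v w; rewrite coefP.
  pose f : {linear L -> F^o} :=
    HB.pack (fun v : L => coef v a : F^o) (GRing.isLinear.Build _ _ _ _ _ f_lin).
  suff /subvP/(_ u us) : (cspan s <= lker (linfun f))%VS.
    by rewrite memv_ker lfunE => /eqP.
  apply/span_subvP => _ /mapP[b bs ->]; rewrite memv_ker lfunE /= of_coefK /delta.
  by case: (a =P b) as_ => [->|_]; rewrite ?bs ?eqxx.
rewrite [u]coef_expand; apply: memv_suml => a _.
have [as_|/u0 ->] := boolP (a \in s); last by rewrite scale0r mem0v.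
by apply/memvZ/memv_span/map_f.
Qed.

Lemma dim_cspan s : uniq s -> \dim (cspan s) = size s.
Proof.
move=> us; have [B _ _ _] := model_standard P.
rewrite -(size_map (mbasis P)); apply/eqP; rewrite -/(free _).
pose s' := [seq a <- enum (gen n) | a \notin s].
apply: (catl_free (Y := map (mbasis P) s')); rewrite -map_cat.
rewrite (perm_free (Y := codom (mbasis P))) ?(basis_free B) //.
apply/perm_map/uniq_perm => [|| a]; rewrite ?enum_uniq //.
  rewrite cat_uniq us filter_uniq ?enum_uniq // andbT.
  by apply/hasPn => a; rewrite mem_filter => /andP[].
by rewrite mem_cat mem_filter mem_enum andbT orbN.
Qed.

Lemma coef_prod (u v : L) a :
  coef (u · v) a = triform P (coef u) (coef v) (cdual F a).
Proof. exact: coef_mul. Qed.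

Lemma model_presentation :
  (forall a b c r, (a, b, c, r) \in P ->
    triform P (delta F a) (delta F b) (delta F c) = r) ->
  has_presentation L P.
Proof.
move=> HP; exists (mbasis P); first exact: model_standard.
split=> [a b c r /HP|a b c nP]; rewrite mbasis_triple // /triform.
rewrite big_seq big1 // => -[[[a' b'] c'] r] /nP nperm /=.
by rewrite minor3_delta_eq0 ?mulr0.
Qed.

End CoordinateSubspaces.

(** * The algebra presented by P10_4_3 is of type B *)

Section Example.
Variable F : fieldType.
Notation P := (P10_4_3 F).
Notation L := (model P).
Implicit Types u v w t : L.

Lemma triformE (f g h : gen 5 -> F) : triform P f g h =
  minor3 'x_1 'y_2 'y_3 f g h + minor3 'y_1 'y_2 'y_4 f g h
  + minor3 'y_1 'y_3 'y_5 f g h.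
Proof. by rewrite /triform !big_cons big_nil /= addr0 !mul1r addrA. Qed.

Lemma model_has_presentation : has_presentation L P.
Proof.
apply: model_presentation => a b c r; rewrite !inE.
by case/or3P => /eqP[-> -> -> ->]; rewrite triformE /minor3 /delta !eqE /=; ring.
Qed.

Definition indices_L2 : seq (gen 5) := [:: 'x_1; 'x_2; 'x_3; 'x_4; 'x_5; 'y_1].
Definition indices_Z : seq (gen 5) := [:: 'x_2; 'x_3; 'x_4; 'x_5].

Lemma gen5P (Q : gen 5 -> Prop) :
    Q 'x_1 -> Q 'x_2 -> Q 'x_3 -> Q 'x_4 -> Q 'x_5 ->
    Q 'y_1 -> Q 'y_2 -> Q 'y_3 -> Q 'y_4 -> Q 'y_5 ->
  forall a, Q a.
Proof.
move=> x1 x2 x3 x4 x5 y1 y2 y3 y4 y5.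
by case=> [] [[|[|[|[|[|//]]]]] i5]; rewrite (eq_irrelevance i5 isT).
Qed.

Lemma mbasis_mul (a b c : gen 5) :
  (forall d, triform P (delta F a) (delta F b) (cdual F d) = delta F c d) ->
  mbasis P a · mbasis P b = mbasis P c.
Proof.
move=> abc; apply/ffunP => d; rewrite [LHS]coef_mul ffunE -abc.
by apply: eq_triform => x; rewrite ?of_coefK.
Qed.

Ltac eval_triple := rewrite triformE /minor3 /delta !eqE /=; ring.
Ltac eval_product :=
  apply: mbasis_mul; apply: gen5P; rewrite /cdual; eval_triple.

(** The coordinates that vanish are recovered by pairing u · v against well
    chosen basis vectors; each of them is a triple of u with two basis vectors. *)
Lemma model_center : saa_center L = cspan P indices_Z.
Proof.
apply/vspaceP => u; apply/mem_center/mem_cspan => [u0 a | u0 v].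
  have T b c : triform P (coef u) (delta F b) (delta F c) = 0.
    have := congr1 (fun w : L => ⟨w, mbasis P c⟩) (u0 (mbasis P b)).
    rewrite form0l [X in X = _ -> _]model_triple => <-.
    by apply: eq_triform => x; rewrite ?of_coefK.
  move: a; apply: gen5P => // _.
  - by rewrite -(T 'y_2 'y_3); eval_triple.
  - by rewrite -(T 'y_2 'y_4); eval_triple.
  - by rewrite -(T 'y_3 'x_1); eval_triple.
  - by rewrite -(T 'x_1 'y_2); eval_triple.
  - by rewrite -(T 'y_1 'y_2); eval_triple.
  - by rewrite -(T 'y_1 'y_3); eval_triple.
apply: form_inj => w; rewrite [LHS]model_triple form0l triformE /minor3.
by rewrite (u0 'x_1) // !(u0 (inr _)) //; ring.
Qed.

Lemma mem_L2 t : t \in cspan P indices_L2 ->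
  [/\ coef t 'y_2 = 0, coef t 'y_3 = 0, coef t 'y_4 = 0 & coef t 'y_5 = 0].
Proof. by move/mem_cspan=> t0; split; apply: t0. Qed.

Lemma model_pow2 : saa_pow L 2 = cspan P indices_L2.
Proof.
apply/eqP; rewrite eqEsubv; apply/andP; split.
  apply/prod_vspaceP => u v _ _; apply/mem_cspan; apply: gen5P => // _;
    by rewrite coef_prod triformE /minor3 /= /delta !eqE /=; ring.
apply/span_subvP => _ /mapP[a + ->]; rewrite !inE.
have P2 b c : mbasis P b · mbasis P c \in saa_pow L 2.
  by apply: memv_prod_vspace; apply: memvf.
case/or4P => [/eqP->|/eqP->|/eqP->|/or3P[/eqP->|/eqP->|/eqP->]].
- have <- : mbasis P 'y_2 · mbasis P 'y_4 = mbasis P 'x_1 by eval_product.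
  exact: P2.
- have <- : mbasis P 'y_4 · mbasis P 'y_1 = mbasis P 'x_2 by eval_product.
  exact: P2.
- have <- : mbasis P 'x_1 · mbasis P 'y_2 = mbasis P 'x_3 by eval_product.
  exact: P2.
- have <- : mbasis P 'y_1 · mbasis P 'y_2 = mbasis P 'x_4 by eval_product.
  exact: P2.
- have <- : mbasis P 'y_1 · mbasis P 'y_3 = mbasis P 'x_5 by eval_product.
  exact: P2.
- have <- : mbasis P 'y_3 · mbasis P 'y_2 = mbasis P 'y_1 by eval_product.
  exact: P2.
Qed.

Lemma model_pow3 : saa_pow L 3 = cspan P indices_Z.
Proof.
apply/eqP; rewrite eqEsubv; apply/andP; split.
  rewrite saa_powS model_pow2; apply/prod_vspaceP => u v /mem_L2[u2 u3 u4 u5] _.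
  apply/mem_cspan; apply: gen5P => // _;
    by rewrite coef_prod triformE /minor3 /= /delta !eqE /= u2 u3 u4 u5; ring.
apply/span_subvP => _ /mapP[a + ->]; rewrite !inE.
have P3 b c : b \in indices_L2 -> mbasis P b · mbasis P c \in saa_pow L 3.
  move=> b2; rewrite saa_powS model_pow2; apply: memv_prod_vspace; last exact: memvf.
  exact/memv_span/map_f.
case/or4P => /eqP->.
- have <- : mbasis P 'x_1 · (- mbasis P 'y_3) = mbasis P 'x_2.
    rewrite prodNr -prod_swap; eval_product.
  rewrite prodNr memvN; exact: P3.
- have <- : mbasis P 'x_1 · mbasis P 'y_2 = mbasis P 'x_3 by eval_product.
  exact: P3.
- have <- : mbasis P 'y_1 · mbasis P 'y_2 = mbasis P 'x_4 by eval_product.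
  exact: P3.
- have <- : mbasis P 'y_1 · mbasis P 'y_3 = mbasis P 'x_5 by eval_product.
  exact: P3.
Qed.

(** For t in the square, the Pfaffian of phi_t is, up to sign, the square of the
    coordinate of t at y_1, so the degenerate classes form the line of x_1. *)
Lemma model_typeB : saa_typeB L.
Proof.
rewrite /saa_typeB /saa_phi_degenerate model_pow2 model_center; exists (mbasis P 'x_1).
have T t u v : saa_phi t u v = triform P (coef t) (coef u) (coef v) by exact: model_triple.
split.
- exact/memv_span/map_f.
- apply/negP => /mem_cspan/(_ 'x_1 isT)/eqP; by rewrite of_coefK /delta eqxx oner_eq0.
- exists (mbasis P 'y_4).
    apply/negP => /mem_cspan/(_ 'y_4 isT)/eqP; by rewrite of_coefK /delta eqxx oner_eq0.
  move=> v; rewrite T triformE /minor3 !of_coefK /delta !eqE /=; ring.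
move=> t t2 tn [u un u0]; have [t_2 t_3 t_4 t_5] := mem_L2 t2.
have t1 : coef t 'y_1 != 0.
  apply: contra tn => /eqP t1; apply/memv_addP.
  pose k := coef t 'x_1.
  exists (t - k *: mbasis P 'x_1); last first.
    by exists (k *: mbasis P 'x_1); rewrite ?memvZ ?memv_line ?subrK.
  apply/mem_cspan.
  have E a : coef (t - k *: mbasis P 'x_1) a = coef t a - k * delta F 'x_1 a.
    by rewrite addrC -scaleNr coefP of_coefK mulNr addrC.
  by apply: gen5P => // _; rewrite E /delta ?t1 ?t_2 ?t_3 ?t_4 ?t_5 !eqE /= /k; ring.
have D (w : F) : coef t 'y_1 * w = 0 -> w = 0.
  by move/eqP; rewrite mulf_eq0 (negPf t1) => /eqP.
have Tu (v : L) : coef t 'x_1 * (coef u 'y_2 * coef v 'y_3 - coef u 'y_3 * coef v 'y_2) +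
  coef t 'y_1 * (coef u 'y_2 * coef v 'y_4 - coef u 'y_4 * coef v 'y_2
    + (coef u 'y_3 * coef v 'y_5 - coef u 'y_5 * coef v 'y_3)) = 0.
  by rewrite -(u0 v) T triformE /minor3 t_2 t_3 t_4 t_5; ring.
have u2 : coef u 'y_2 = 0.
  by apply: D; rewrite -(Tu (mbasis P 'y_4)) !of_coefK /delta !eqE /=; ring.
have u3 : coef u 'y_3 = 0.
  by apply: D; rewrite -(Tu (mbasis P 'y_5)) !of_coefK /delta !eqE /=; ring.
have u4 : coef u 'y_4 = 0.
  apply/D/oppr_inj.
  by rewrite oppr0 -(Tu (mbasis P 'y_2)) !of_coefK u2 u3 /delta !eqE /=; ring.
have u5 : coef u 'y_5 = 0.
  apply/D/oppr_inj.
  by rewrite oppr0 -(Tu (mbasis P 'y_3)) !of_coefK u2 u3 /delta !eqE /=; ring.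
by case/negP: un; apply/mem_cspan; apply: gen5P.
Qed.

Lemma model_nilpotent_typeB : nilpotent_10_4_3_typeB L.
Proof.
split.
- split; last exact: dim_model.
  exists 3%N; apply/eqP; rewrite -subv0 saa_powS model_pow3 -model_center.
  apply/prod_vspaceP => u v /mem_center-> _.
  exact: mem0v.
- rewrite model_center => u v /mem_cspan u0 /mem_cspan v0.
  rewrite [LHS]/(model_form u v) /model_form big1 // => i _.
  by rewrite (u0 (inr i)) ?(v0 (inr i)) ?mulr0 ?mul0r ?subrr.
- by rewrite model_center dim_cspan.
- by rewrite model_pow3 model_center.
- exact: model_typeB.
Qed.

End Example.

(** * Orthogonality and dimension *)

Lemma dim_addv_line (F : fieldType) (V : vectType F) (U : {vspace V}) v :
  v \notin U -> \dim (U + <[v]>) = (\dim U).+1.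
Proof.
move=> vU; rewrite dimv_disjoint_sum.
  rewrite dim_vline (_ : v != 0) ?addn1 //.
  by apply: contraNneq vU => ->; apply: mem0v.
apply/eqP; rewrite -subv0; apply/subvP => w; rewrite memv_cap => /andP[wU].
case/vlineP => k wE; rewrite wE memv0 in wU *.
apply: contraNT vU; rewrite scaler_eq0 => /norP[k0 _].
by rewrite -(scale1r v) -(mulVf k0) -scalerA memvZ.
Qed.

Section Orthogonality.
Variables (F : fieldType) (L : saa F).
Implicit Types (u v w z t : L) (U W : {vspace L}).

Section Pairing.
Variables (k : nat) (y : 'I_k -> L).

Definition pairing_row u : 'rV[F]_k := \row_i ⟨u, y i⟩.

Fact pairing_row_linear : linear pairing_row.
Proof. by move=> a u v; apply/rowP => i; rewrite !mxE !formE. Qed.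

HB.instance Definition _ :=
  GRing.isLinear.Build F L 'rV[F]_k _ pairing_row pairing_row_linear.

Definition pairing : 'Hom(L, 'rV[F]_k) := linfun pairing_row.

Lemma pairingE u i : pairing u 0 i = ⟨u, y i⟩.
Proof. by rewrite lfunE mxE. Qed.

Lemma mem_ker_pairing u : reflect (forall i, ⟨u, y i⟩ = 0) (u \in lker pairing).
Proof.
rewrite memv_ker; apply: (iffP eqP) => [u0 i | u0].
  by rewrite -pairingE u0 mxE.
by apply/rowP => i; rewrite pairingE mxE u0.
Qed.

Lemma dim_img_pairing U : (\dim (pairing @: U) <= k)%N.
Proof. by have := dimvS (subvf (pairing @: U)); rewrite dimvf /dim /= mul1n. Qed.

End Pairing.

(** An injective linear map between spaces of equal dimension is onto. *)
Lemma pairing_onto k (y : 'I_k -> L) U (a : 'I_k -> F) :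
    \dim U = k -> (forall u, u \in U -> (forall i, ⟨u, y i⟩ = 0) -> u = 0) ->
  exists2 x, x \in U & forall i, ⟨x, y i⟩ = a i.
Proof.
move=> dimU yU.
have Uker : (U :&: lker (pairing y) = 0)%VS.
  apply/eqP; rewrite -subv0; apply/subvP => u; rewrite memv_cap memv0.
  by move=> /andP[uU /mem_ker_pairing/(yU _ uU)->].
have imU : (pairing y @: U = fullv)%VS.
  apply/eqP; rewrite eqEdim subvf limg_dim_eq // dimU dimvf.
  by rewrite /dim /= mul1n.
have : \row_i a i \in (pairing y @: U)%VS by rewrite imU memvf.
case/memv_imgP => x xU aE; exists x => // i.
by rewrite -pairingE -aE mxE.
Qed.

(** The form embeds W in the dual of a complement of U, and W is the kernel of
    the map from L to the dual of U; these give the two inequalities. *)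
Lemma dim_orthogonal U W :
    (forall u, u \in W <-> forall v, v \in U -> ⟨u, v⟩ = 0) ->
  (\dim W + \dim U)%N = \dim {:L}.
Proof.
move=> WU; have inb V (u : L) : (forall i : 'I_(\dim V), ⟨u, (vbasis V)`_i⟩ = 0) ->
    forall v, v \in V -> ⟨u, v⟩ = 0.
  move=> u0 v /coord_vbasis ->; rewrite form_sumr big1 // => i _.
  by rewrite formZr u0 mulr0.
apply/eqP; rewrite eqn_leq; apply/andP; split.
  pose y i := (vbasis U^C)`_i.
  have kW : (W :&: lker (pairing (fun i : 'I_(\dim U^C) => y i)) = 0)%VS.
    apply/eqP; rewrite -subv0; apply/subvP => u; rewrite memv_cap memv0.
    move=> /andP[/WU uU /mem_ker_pairing/inb uC]; apply/eqP.
    apply: saa_form_nondeg => v; have := memvf v; rewrite -(addv_complf U).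
    by case/memv_addP => a aU [b bU ->]; rewrite formDr uU // uC // addr0.
  rewrite addnC -leq_subRL ?dimvS ?subvf // -dimv_compl -(limg_dim_eq kW).
  exact: dim_img_pairing.
pose f := pairing (fun i : 'I_(\dim U) => (vbasis U)`_i).
rewrite -(limg_ker_dim f fullv) leq_add ?dim_img_pairing //.
apply/dimvS/subvP => u; rewrite memv_cap => /andP[_ /mem_ker_pairing/inb uU].
exact/WU.
Qed.

End Orthogonality.

(** * Classification: every type B algebra has the presented basis *)

(** An alternating trilinear symbol is determined by its values on increasing
    triples; this leaves few products to compute. *)
Lemma alternating_eq0 (T : Type) (V : zmodType) (key : T -> nat) (h : T -> T -> T -> V) :
    injective key ->
    (forall a b, h a a b = 0) -> (forall a b c, h a b c = h b c a) ->
    (forall a b c, h a b c = - h b a c) ->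
    (forall a b c, (key a < key b)%N -> (key b < key c)%N -> h a b c = 0) ->
  forall a b c, h a b c = 0.
Proof.
move=> key_inj alt rot swap sorted.
have lt_ab a b c : (key a < key b)%N -> h a b c = 0.
  move=> ab; case: (ltngtP (key b) (key c)) => [bc|cb|/key_inj->].
  - exact: sorted.
  - case: (ltngtP (key a) (key c)) => [ac|ca|/key_inj->].
    + by rewrite swap rot sorted ?oppr0.
    + by rewrite -rot sorted.
    + by rewrite -rot alt.
  - by rewrite rot alt.
move=> a b c; case: (ltngtP (key a) (key b)) => [|ba|/key_inj->] //; first exact: lt_ab.
by rewrite swap lt_ab ?oppr0.
Qed.

Section TypeB.
Variables (F : fieldType) (L : saa F).
Hypotheses (dimL : \dim {:L} = 10%N) (dimZ : \dim (saa_center L) = 4%N).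
Hypothesis powL3 : saa_pow L 3 = saa_center L.
Notation Z := (saa_center L).
Notation L2 := (saa_pow L 2).
Implicit Types (u v w z t : L).

Lemma Z_L2 u v : u \in Z -> v \in L2 -> ⟨u, v⟩ = 0.
Proof. by move=> /center_orthogonal; apply. Qed.

Lemma L2_mul u v : u \in L2 -> u · v \in Z.
Proof. by move=> u2; rewrite -powL3 memv_prod_vspace ?memvf. Qed.

Lemma sub_Z_L2 u : u \in Z -> u \in L2.
Proof.
rewrite -powL3; apply/subvP/prod_vspaceP => a b _ _.
by rewrite memv_prod_vspace ?memvf.
Qed.

Lemma L2_abelian u v : u \in L2 -> v \in L2 -> u · v = 0.
Proof.
move=> u2 v2; apply: saa_form_nondeg => w; rewrite triple_rot.
by apply: Z_L2 => //; apply: L2_mul.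
Qed.

Lemma dim_L2 : \dim L2 = 6%N.
Proof.
have := dim_orthogonal (@center_orthogonal _ L).
by rewrite dimL dimZ; move/(@addnI 4 _ 6).
Qed.

(** Equivalent, for the orthogonal Z of L2, to the y_i spanning L modulo L2; unlike
    spanning, this form visibly survives a change of the y_i modulo L2. *)
Definition separating (y1 y2 y3 y4 : L) :=
  forall u, u \in Z -> ⟨u, y1⟩ = 0 -> ⟨u, y2⟩ = 0 -> ⟨u, y3⟩ = 0 -> ⟨u, y4⟩ = 0 ->
  u = 0.

(** An element t of L2 not orthogonal to z gives a whole family t - kz outside
    Z + <z>, since z is orthogonal to both Z and itself. *)
Lemma typeB_pencil : saa_typeB L ->
  exists z t, [/\ z \in L2, t \in L2, ⟨z, t⟩ = 1,
    exists2 u0, u0 \notin L2 & z · u0 = 0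
    & forall k u, (t - k *: z) · u = 0 -> u \in L2].
Proof.
case=> z [z2 zZ [u0 u02 zu0] tB].
have [t0 t02 zt0] : exists2 t, t \in L2 & ⟨z, t⟩ != 0.
  have : ~~ (L2 <= lker (linfun (saa_form L z : L -> F^o)))%VS.
    apply: contra zZ => /subvP zL2; apply/center_orthogonal => v /zL2.
    by rewrite memv_ker lfunE => /eqP.
  by case/subvPn => t t2; rewrite memv_ker lfunE; exists t.
pose t := ⟨z, t0⟩^-1 *: t0.
have zt : ⟨z, t⟩ = 1 by rewrite formZr mulVf.
have t2 : t \in L2 by rewrite memvZ.
exists z, t; split=> //.
  by exists u0 => //; apply: saa_form_nondeg => v; apply: zu0.
move=> k u tu; apply: contraTT (oner_neq0 F) => u2; rewrite negbK.
have tk2 : t - k *: z \in L2 by rewrite rpredB ?memvZ.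
have tkZ : t - k *: z \notin (Z + <[z]>)%VS.
  apply: contra_neqN (oner_neq0 F) => /memv_addP[c cZ [_ /vlineP[l ->] E]].
  rewrite -zt -[t](subrK (k *: z)) E !formE saa_form_alt !mulr0 !addr0.
  by rewrite form_swap Z_L2 ?oppr0.
by case: (tB _ tk2 tkZ); exists u => // v; rewrite /saa_phi tu form0l.
Qed.

(** The radical of phi_z on L/L2 contains u0.  If phi_z(y2, y3) is nonzero, the
    orthogonal of y2 and y3 is, modulo L2, a plane spanned by u0 and some u1, and
    an alternating form on a plane with u0 in its radical is zero; so u1 is in the
    radical too. *)
Lemma rank_one_frame z u0 :
    z \in L2 -> z \notin Z -> u0 \notin L2 -> z · u0 = 0 ->
  exists y2 y3 u1, [/\ ⟨z · y2, y3⟩ != 0, z · u1 = 0,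
    separating y2 y3 u0 u1 & forall p q, p *: u0 + q *: u1 \in L2 -> p = 0 /\ q = 0].
Proof.
move=> z2 zZ u02 zu0.
have [y2 [y3 y23]] : exists y2 y3, ⟨z · y2, y3⟩ != 0.
  have : ~~ (fullv <= lker (linfun (saa_mul L z)))%VS.
    apply: contra zZ => /subvP zL; apply/mem_center => v.
    by have := zL v (memvf v); rewrite memv_ker lfunE => /eqP.
  case/subvPn => y2 _; rewrite memv_ker lfunE /= => zy2.
  have : ~~ (fullv <= lker (linfun (saa_form L (z · y2) : L -> F^o)))%VS.
    apply: contra zy2 => /subvP zL; apply/eqP/saa_form_nondeg => v.
    by have := zL v (memvf v); rewrite memv_ker lfunE => /eqP.
  by case/subvPn => y3 _; rewrite memv_ker lfunE; exists y2, y3.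
wlog zy23 : y3 y23 / ⟨z · y2, y3⟩ = 1.
  move=> /(_ (⟨z · y2, y3⟩^-1 *: y3)); rewrite formZr mulVf ?oner_neq0 //.
  case/(_ isT erefl) => y2' [y3' [u1 H]]; by exists y2', y3', u1.
have memD U (u : L) a b : u \in (U + <[a]>)%VS -> ⟨b, a⟩ = 0 ->
    (forall v, v \in U -> ⟨b, v⟩ = 0) -> ⟨b, u⟩ = 0.
  move=> /memv_addP[v vU [_ /vlineP[k ->] ->]] ba bU.
  by rewrite formDr formZr ba bU // mulr0 addr0.
have zL2 u v : u \in L2 -> ⟨z · v, u⟩ = 0 by move=> u2; rewrite Z_L2 ?L2_mul.
(* Each step adds one dimension to L2, of dimension 6: W1 lies in the radical of
   phi_z but y2 does not, and ⟨z · y2, _⟩ vanishes on W2 but not at y3. *)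
pose W1 := (L2 + <[u0]>)%VS; pose W2 := (W1 + <[y2]>)%VS.
pose W3 := (W2 + <[y3]>)%VS.
have zW1 v u : u \in W1 -> ⟨z · v, u⟩ = 0.
  move=> uW; apply: memD uW _ _ => [|w w2]; last exact: zL2.
  by rewrite triple_swapr zu0 form0l oppr0.
have dimW3 : \dim W3 = 9%N.
  rewrite !dim_addv_line ?dim_L2 //.
    apply: contra_neqN (oner_neq0 F) => y2W.
    by rewrite -zy23 triple_swapr zW1 ?oppr0.
  apply: contra_neqN (oner_neq0 F) => y3W; rewrite -zy23.
  by apply: memD y3W _ _ => [|v /zW1 //]; apply: triple_altr.
have [v vW3] : exists v, v \notin W3.
  have : ~~ (fullv <= W3)%VS.
    by apply/negP => /dimvS; rewrite dimL dimW3.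
  by case/subvPn => v _; exists v.
(* The projection of v on the phi_z-orthogonal of y2 and y3. *)
pose u1 := v - ⟨z · v, y3⟩ *: y2 - ⟨z · y2, v⟩ *: y3.
have u1W3 : u1 \notin W3.
  apply: contra vW3 => u1W3.
  have y2W : y2 \in W3.
    by apply/(subvP (addvSl _ _))/(subvP (addvSr _ _))/memv_line.
  have y3W : y3 \in W3 by apply/(subvP (addvSr _ _))/memv_line.
  have -> : v = u1 + ⟨z · y2, v⟩ *: y3 + ⟨z · v, y3⟩ *: y2 by rewrite !subrK.
  by apply: memvD; [apply: memvD => // |]; apply: memvZ.
have full : (W3 + <[u1]>)%VS = fullv.
  by apply/eqP; rewrite eqEdim subvf dim_addv_line // dimL dimW3.
have sep : separating y2 y3 u0 u1.
  move=> u uZ ey2 ey3 eu0 eu1; apply: saa_form_nondeg => w.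
  have := memvf w; rewrite -full => /memD; apply=> // {}w /memD; apply=> // {}w.
  by move=> /memD; apply=> // {}w /memD; apply=> // {}w; apply: Z_L2.
exists y2, y3, u1; split=> //.
- apply: sep; rewrite ?L2_mul //.
  + rewrite triple_swapr /u1 !formE triple_altr zy23; ring.
  + rewrite /u1 !(prodE, formE) triple_altr zy23; ring.
  + by rewrite triple_swapr zu0 form0l oppr0.
  + exact: triple_altr.
- move=> p q pq2; have q0 : q = 0.
    apply: contraNeq u1W3 => q0.
    have -> : u1 = q^-1 *: ((p *: u0 + q *: u1) + (- p) *: u0).
      by rewrite scaleNr addrAC subrr add0r scalerA mulVf ?scale1r.
    apply/memvZ/(subvP (addvSl _ _))/(subvP (addvSl _ _)).
    by apply: memv_add => //; apply/memvZ/memv_line.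
  split=> //; apply: contraNeq u02 => p0; rewrite q0 scale0r addr0 in pq2.
  by rewrite -(scale1r u0) -(mulVf p0) -scalerA memvZ.
Qed.

(** Linear algebra of the pencil t - kz: R = <u0, u1> is isotropic for phi_t,
    and nondegeneracy of phi_t then makes the matrix pairing R with <y2, y3>
    invertible. *)
Lemma adapted_frame : saa_typeB L ->
  exists z t y2 y3 y4 y5,
    [/\ [/\ z \in L2, t \in L2 & ⟨z, t⟩ = 1], separating y2 y3 y4 y5,
        [/\ ⟨z · y2, y3⟩ = 1, z · y4 = 0 & z · y5 = 0],
        [/\ ⟨t · y2, y3⟩ = 0, ⟨t · y2, y4⟩ = 1 & ⟨t · y2, y5⟩ = 0]
      & [/\ ⟨t · y3, y4⟩ = 0, ⟨t · y3, y5⟩ = 1 & ⟨t · y4, y5⟩ = 0]].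
Proof.
case/typeB_pencil => z1 [t1 [z12 t12 zt1 [u0 u02 zu0] pencil1]].
have z1Z : z1 \notin Z.
  by apply: contra_neqN (oner_neq0 F) => z1Z; rewrite -zt1 Z_L2.
have [y2 [y3 [u1 [y23 zu1 sep free]]]] := rank_one_frame z12 z1Z u02 zu0.
(* z is normalized on y2, y3, and t rescaled inversely to keep ⟨z, t⟩ = 1. *)
pose k := ⟨z1 · y2, y3⟩.
pose z := k^-1 *: z1; pose t := k *: t1.
have z2 : z \in L2 by apply: memvZ.
have t2 : t \in L2 by apply: memvZ.
have zt : ⟨z, t⟩ = 1 by rewrite formZl formZr mulrA mulVf ?mul1r.
have zy23 : ⟨z · y2, y3⟩ = 1 by rewrite prodZl formZl mulVf.
have pencil m u : (t - m *: z) · u = 0 -> u \in L2.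
  move=> mu; apply: (pencil1 (k^-1 * m * k^-1)).
  apply: (scalerI y23); rewrite -prodZl scalerBr !scalerA scaler0 -mu /z scalerA.
  by rewrite 2!mulrA mulfV // mul1r.
have {}zu0 : z · u0 = 0 by rewrite prodZl zu0 scaler0.
have {}zu1 : z · u1 = 0 by rewrite prodZl zu1 scaler0.
clearbody z t.
have zR r v : z · r = 0 -> ⟨z · v, r⟩ = 0.
  by move=> zr; rewrite triple_swapr zr form0l oppr0.
have tu01 : ⟨t · u0, u1⟩ = 0.
  apply: contraNeq (oner_neq0 F) => kn0; set q := ⟨t · u0, u1⟩ in kn0.
  (* If phi_t(u0, u1) were nonzero, y would be the phi_t-orthogonal correction of
     y2 by R, and killed by t - kz for k = phi_t(y, y3). *)
  pose a := - (⟨t · y2, u1⟩ / q); pose b := ⟨t · y2, u0⟩ / q.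
  pose y := y2 + a *: u0 + b *: u1.
  have y0 : ⟨t · y, u0⟩ = 0.
    rewrite !(prodE, formE) triple_altr (triple_swapr t u1) -/q /b; field.
    exact: kn0.
  have y1 : ⟨t · y, u1⟩ = 0.
    rewrite !(prodE, formE) triple_altr -/q /a; field.
    exact: kn0.
  have zy3 : ⟨z · y, y3⟩ = 1.
    by rewrite !(prodE, formE) zu0 zu1 !form0l zy23; ring.
  suff /pencil/(L2_abelian z2) yL2 : (t - ⟨t · y, y3⟩ *: z) · y = 0.
    by rewrite -zy3 yL2 form0l.
  set w := _ · _.
  have wE v : ⟨w, v⟩ = ⟨t · y, v⟩ - ⟨t · y, y3⟩ * ⟨z · y, v⟩.
    by rewrite /w prodDl formDl prodNl prodZl formNl formZl.
  have w0 : ⟨w, u0⟩ = 0 by rewrite wE y0 zR // mulr0 subr0.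
  have w1 : ⟨w, u1⟩ = 0 by rewrite wE y1 zR // mulr0 subr0.
  apply: sep => //.
  - by rewrite L2_mul // rpredB ?memvZ.
  - have <- : ⟨w, y⟩ = ⟨w, y2⟩ by rewrite /y !formE w0 w1; ring.
    by rewrite wE !triple_altr mulr0 subr0.
  - by rewrite wE zy3 mulr1 subrr.
pose a := ⟨t · y2, u0⟩; pose b := ⟨t · y2, u1⟩.
pose c := ⟨t · y3, u0⟩; pose d := ⟨t · y3, u1⟩.
have inj p q : p * a + q * b = 0 -> p * c + q * d = 0 -> p = 0 /\ q = 0.
  move=> pq2 pq3; apply: free; apply: (pencil 0); rewrite scale0r subr0.
  apply: sep; first exact: L2_mul.
  - by rewrite triple_swapr !formE pq2 oppr0.
  - by rewrite triple_swapr !formE pq3 oppr0.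
  - by rewrite !(prodE, formE) triple_altr (triple_swapr t u1) tu01; ring.
  - by rewrite !(prodE, formE) triple_altr tu01; ring.
(* If the determinant vanished, a row of the adjugate matrix would give a
   nontrivial relation. *)
have D0 : a * d - b * c != 0.
  apply/eqP => D0.
  have [d0 /eqP] : d = 0 /\ - c = 0 by apply: inj; [rewrite -D0 | ]; ring.
  rewrite oppr_eq0 => /eqP c0.
  have [b0 /eqP] : b = 0 /\ - a = 0 by apply: inj; rewrite ?c0 ?d0; ring.
  rewrite oppr_eq0 => /eqP a0.
  have [/eqP] : (1 : F) = 0 /\ (0 : F) = 0 by apply: inj; rewrite ?a0 ?b0 ?c0 ?d0; ring.
  by rewrite oner_eq0.
set D := a * d - b * c in D0.
pose y4 := D^-1 *: (d *: u0 - c *: u1); pose y5 := D^-1 *: (a *: u1 - b *: u0).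
have t24 : ⟨t · y2, y4⟩ = 1 by rewrite !formE -/a -/b /D; field; exact: D0.
have t25 : ⟨t · y2, y5⟩ = 0 by rewrite !formE -/a -/b; ring.
have t34 : ⟨t · y3, y4⟩ = 0 by rewrite !formE -/c -/d; ring.
have t35 : ⟨t · y3, y5⟩ = 1 by rewrite !formE -/c -/d /D; field; exact: D0.
have t45 : ⟨t · y4, y5⟩ = 0.
  rewrite !(prodE, formE) !triple_altr (triple_swapr t u1) tu01; ring.
have u0E u : ⟨u, u0⟩ = a * ⟨u, y4⟩ + c * ⟨u, y5⟩.
  by rewrite !formE /D; field; exact: D0.
have u1E u : ⟨u, u1⟩ = b * ⟨u, y4⟩ + d * ⟨u, y5⟩.
  by rewrite !formE /D; field; exact: D0.
pose e := ⟨t · y2, y3⟩.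
have zy4 : z · y4 = 0 by rewrite !prodE zu0 zu1 !scaler0 subr0 scaler0.
have zy5 : z · y5 = 0 by rewrite !prodE zu0 zu1 !scaler0 subr0 scaler0.
(* phi_t(y5, y3) = -1, so e *: y5 cancels phi_t(y2, y3). *)
exists z, t, (y2 + e *: y5), y3, y4, y5; split=> //.
- move=> u uZ e2 e3 e4 e5; apply: sep => //.
  + by move: e2; rewrite formDr formZr e5 mulr0 addr0.
  + by rewrite u0E e4 e5; ring.
  + by rewrite u1E e4 e5; ring.
- by split=> //; rewrite prodDr prodZr zy5 scaler0 addr0.
- split; rewrite prodDr prodZr formDl formZl.
  + by rewrite (triple_swapr t y5) t35 -/e mulrN1 subrr.
  + by rewrite t24 (triple_swapr t y5) t45 oppr0 mulr0 addr0.
  + by rewrite t25 triple_altr mulr0 addr0.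
Qed.

(** Shifting y3, y2, y5 and y4 by multiples of t changes respectively the triples
    234, 235, 245 and 345, and each of them no other triple. *)
Lemma reduced_frame : saa_typeB L ->
  exists z t y2 y3 y4 y5,
    [/\ [/\ z \in L2, t \in L2 & ⟨z, t⟩ = 1], separating y2 y3 y4 y5,
        [/\ ⟨z · y2, y3⟩ = 1, z · y4 = 0 & z · y5 = 0],
        [/\ ⟨t · y2, y3⟩ = 0, ⟨t · y2, y4⟩ = 1, ⟨t · y2, y5⟩ = 0 &
          [/\ ⟨t · y3, y4⟩ = 0, ⟨t · y3, y5⟩ = 1 & ⟨t · y4, y5⟩ = 0]]
      & [/\ ⟨y2 · y3, y4⟩ = 0, ⟨y2 · y3, y5⟩ = 0, ⟨y2 · y4, y5⟩ = 0
        & ⟨y3 · y4, y5⟩ = 0]].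
Proof.
case/adapted_frame=> // z [t [y2 [y3 [y4 [y5 [[z2 t2 zt] sep [z23 z4 z5]]]]]]].
case=> t23 t24 t25 [t34 t35 t45].
have zt0 : z · t = 0 by apply: L2_abelian.
exists z, t, (y2 + (- ⟨y2 · y3, y5⟩) *: t), (y3 + ⟨y2 · y3, y4⟩ *: t).
exists (y4 + ⟨y3 · y4, y5⟩ *: t), (y5 + (- ⟨y2 · y4, y5⟩) *: t).
have tS u v a b : ⟨t · (u + a *: t), v + b *: t⟩ = ⟨t · u, v⟩.
  by rewrite !(prodE, formE) saa_mul_alt !form0l triple_altl; ring.
have zS u a : z · (u + a *: t) = z · u by rewrite prodDr prodZr zt0 scaler0 addr0.
split=> //.
- move=> u uZ.
  have uS v a : ⟨u, v + a *: t⟩ = ⟨u, v⟩.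
    by rewrite formDr formZr (Z_L2 uZ t2) mulr0 addr0.
  by rewrite !uS; apply: sep.
- by split; rewrite !zS // formDr formZr z23 (Z_L2 (L2_mul _ z2)) ?mulr0 ?addr0.
- by split; rewrite ?tS //; split; rewrite tS.
- by split; rewrite triple_shift ?t23 ?t24 ?t25 ?t34 ?t35 ?t45; ring.
Qed.

Lemma separating_onto y2 y3 y4 y5 a2 a3 a4 a5 : separating y2 y3 y4 y5 ->
  exists2 c, c \in Z &
    [/\ ⟨c, y2⟩ = a2, ⟨c, y3⟩ = a3, ⟨c, y4⟩ = a4 & ⟨c, y5⟩ = a5].
Proof.
move=> sep; pose y (i : 'I_4) := nth 0 [:: y2; y3; y4; y5] i.
pose a (i : 'I_4) := nth 0 [:: a2; a3; a4; a5] i.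
have [u uZ u0|c cZ ca] := @pairing_onto _ _ _ y Z a dimZ.
  apply: sep => //; [exact: (u0 (@Ordinal 4 0 isT)) |
    exact: (u0 (@Ordinal 4 1 isT)) | exact: (u0 (@Ordinal 4 2 isT)) |
    exact: (u0 (@Ordinal 4 3 isT))].
exists c => //; split; [exact: (ca (@Ordinal 4 0 isT)) |
  exact: (ca (@Ordinal 4 1 isT)) | exact: (ca (@Ordinal 4 2 isT)) |
  exact: (ca (@Ordinal 4 3 isT))].
Qed.

Hypothesis isoZ : saa_isotropic (saa_center L).

(** Corrections by elements of Z alter neither products nor triples, and every
    system of values ⟨c, y_i⟩ is taken by some c in Z. *)
Lemma orthogonal_frame : saa_typeB L ->
  exists z t y2 y3 y4 y5,
    [/\ [/\ z \in L2, t \in L2, ⟨z, t⟩ = 1 & separating y2 y3 y4 y5],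
        [/\ ⟨z, y2⟩ = 0, ⟨z, y3⟩ = 0, ⟨z, y4⟩ = 0 & ⟨z, y5⟩ = 0],
        [/\ ⟨t, y2⟩ = 0, ⟨t, y3⟩ = 0, ⟨t, y4⟩ = 0 & ⟨t, y5⟩ = 0],
        [/\ ⟨y2, y3⟩ = 0, ⟨y2, y4⟩ = 0, ⟨y2, y5⟩ = 0 &
          [/\ ⟨y3, y4⟩ = 0, ⟨y3, y5⟩ = 0 & ⟨y4, y5⟩ = 0]]
      & [/\ [/\ ⟨z · y2, y3⟩ = 1, z · y4 = 0 & z · y5 = 0],
        [/\ ⟨t · y2, y3⟩ = 0, ⟨t · y2, y4⟩ = 1 & ⟨t · y2, y5⟩ = 0],
        [/\ ⟨t · y3, y4⟩ = 0, ⟨t · y3, y5⟩ = 1 & ⟨t · y4, y5⟩ = 0]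
      & [/\ ⟨y2 · y3, y4⟩ = 0, ⟨y2 · y3, y5⟩ = 0, ⟨y2 · y4, y5⟩ = 0
        & ⟨y3 · y4, y5⟩ = 0]]].
Proof.
case/reduced_frame=> z [t [y2 [y3 [y4 [y5 [[z2 t2 zt] sep [z23 z4 z5]]]]]]].
case=> t23 t24 t25 [t34 t35 t45] [y234 y235 y245 y345].
have onto a2 a3 a4 a5 := separating_onto a2 a3 a4 a5 sep.
have [cz czZ [cz2 cz3 cz4 cz5]] :=
  onto (- ⟨z, y2⟩) (- ⟨z, y3⟩) (- ⟨z, y4⟩) (- ⟨z, y5⟩).
have [ct ctZ [ct2 ct3 ct4 ct5]] :=
  onto (- ⟨t, y2⟩) (- ⟨t, y3⟩) (- ⟨t, y4⟩) (- ⟨t, y5⟩).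
(* c_i corrects ⟨y_i, y_j⟩ for j > i only, so that the corrections do not interact. *)
have [c2 c2Z [_ c23 c24 c25]] := onto 0 (- ⟨y2, y3⟩) (- ⟨y2, y4⟩) (- ⟨y2, y5⟩).
have [c3 c3Z [c32 _ c34 c35]] := onto 0 0 (- ⟨y3, y4⟩) (- ⟨y3, y5⟩).
have [c4 c4Z [c42 c43 _ c45]] := onto 0 0 0 (- ⟨y4, y5⟩).
have L2Z u v : u \in L2 -> v \in Z -> ⟨u, v⟩ = 0.
  by move=> u2 vZ; rewrite form_swap (Z_L2 vZ u2) oppr0.
have ZL u c : c \in Z -> c · u = 0 by move/mem_center; apply.
have LZ u c : c \in Z -> u · c = 0 by move=> cZ; rewrite prod_swap ZL ?oppr0.
have TZ u v c : c \in Z -> ⟨u · v, c⟩ = 0.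
  by move=> cZ; rewrite -triple_rot ZL // form0l.
have form_add u v c d : c \in Z -> d \in Z ->
    ⟨u + c, v + d⟩ = ⟨u, v⟩ + ⟨c, v⟩ - ⟨d, u⟩.
  by move=> cZ dZ; rewrite !formE (isoZ cZ dZ) (form_swap u d); ring.
have form_addl u v c d : u \in L2 -> c \in Z -> d \in Z ->
    ⟨u + c, v + d⟩ = ⟨u, v⟩ + ⟨c, v⟩.
  by move=> u2 cZ dZ; rewrite form_add // (Z_L2 dZ u2) subr0.
have triple_add u v w a b c : a \in Z -> b \in Z -> c \in Z ->
    ⟨(u + a) · (v + b), w + c⟩ = ⟨u · v, w⟩.
  move=> aZ bZ cZ; rewrite formDr (TZ _ _ c) // prodDl !prodDr (LZ _ b) //.
  by rewrite !(ZL _ a) // !addr0.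
have Z0 : 0 \in Z := mem0v _.
exists (z + cz), (t + ct), (y2 + c2), (y3 + c3), (y4 + c4), (y5 + 0).
have prod_z y c : c \in Z -> (z + cz) · (y + c) = z · y.
  by move=> cZ; rewrite prodDl prodDr (LZ _ c) // (ZL _ cz) // !addr0.
split.
- split; try by rewrite memvD // sub_Z_L2.
    by rewrite form_addl // zt (Z_L2 czZ t2) addr0.
  move=> u uZ; have uS v c : c \in Z -> ⟨u, v + c⟩ = ⟨u, v⟩.
    by move=> cZ; rewrite formDr (isoZ uZ cZ) addr0.
  by rewrite !uS //; apply: sep.
- by rewrite !form_addl // cz2 cz3 cz4 cz5 !subrr.
- by rewrite !form_addl // ct2 ct3 ct4 ct5 !subrr.
- rewrite !form_add // c23 c24 c25 c32 c34 c35 c42 c43 c45 !form0l.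
  by rewrite !(subrr, subr0).
- by rewrite !triple_add // !prod_z.
Qed.

Lemma typeB_standard_basis : saa_typeB L ->
  exists2 e : gen 5 -> L, standard_basis e &
    forall a b c, ⟨e a · e b, e c⟩ =
      triform (P10_4_3 F) (delta F a) (delta F b) (delta F c).
Proof.
case/orthogonal_frame=> z [t [y2 [y3 [y4 [y5 [[z2 t2 zt sep] zy ty yy]]]]]].
case=> -[z23 z4 z5] [t23 t24 t25] [t34 t35 t45] [y234 y235 y245 y345].
have onto a2 a3 a4 a5 := separating_onto a2 a3 a4 a5 sep.
have [x2 x2Z x2y] := onto 1 0 0 0; have [x3 x3Z x3y] := onto 0 1 0 0.
have [x4 x4Z x4y] := onto 0 0 1 0; have [x5 x5Z x5y] := onto 0 0 0 1.
pose e (a : gen 5) := match a with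
  | inl i => nth 0 [:: z; x2; x3; x4; x5] i
  | inr i => nth 0 [:: t; y2; y3; y4; y5] i end.
have L2Z u v : u \in L2 -> v \in Z -> ⟨u, v⟩ = 0.
  by move=> u2 vZ; rewrite form_swap (Z_L2 vZ u2) oppr0.
exists e.
  have xZ : [/\ x2 \in Z, x3 \in Z, x4 \in Z & x5 \in Z] by [].
  apply: standard_basisP => //; try apply: form_eq0_upper.
  - have Lx (i j : 'I_5) : (i < j)%N -> e (inl j) \in Z.
      by move: i j => [[|[|[|[|[|//]]]]] i5] [[|[|[|[|[|//]]]]] j5].
    have L2x (i : 'I_5) : e (inl i) \in L2.
      by case: i => [[|[|[|[|[|//]]]]] i5]; rewrite //= sub_Z_L2.
    by move=> i j /Lx; apply: L2Z.
  - case: ty yy => [ty2 ty3 ty4 ty5] [y23 y24 y25 [y34 y35 y45]].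
    by move=> [[|[|[|[|[|//]]]]] i5] [[|[|[|[|[|//]]]]] j5].
  - case: zy x2y x3y x4y x5y => [zy2 zy3 zy4 zy5] [? ? ? ?] [? ? ? ?] [? ? ? ?] [? ? ? ?].
    by move=> [[|[|[|[|[|//]]]]] i5] [[|[|[|[|[|//]]]]] j5] //=; apply: Z_L2.
move=> a b c; apply/eqP; rewrite -subr_eq0; apply/eqP; move: a b c.
(* With the central vectors first, an increasing triple that contains a central
   vector starts with one. *)
pose s : seq (gen 5) := [:: 'x_2; 'x_3; 'x_4; 'x_5; 'x_1; 'y_1; 'y_2; 'y_3; 'y_4; 'y_5].
have s_all : forall a, a \in s by apply: gen5P.
apply: (@alternating_eq0 _ _ (index^~ s)).
- move=> a b ab.
  by rewrite -(nth_index 'x_1 (s_all a)) ab (nth_index 'x_1 (s_all b)).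
- by move=> a b; rewrite saa_mul_alt form0l triform_alt subrr.
- by move=> a b c; rewrite triple_rot triform_rot.
- move=> a b c; rewrite triple_swap triform_swap; ring.
move=> a b c; have [aZ _ _|] := boolP (a \in indices_Z).
  have -> : e a · e b = 0.
    suff /mem_center : e a \in Z by apply.
    by move: a aZ; apply: gen5P.
  rewrite form0l sub0r triformE /minor3 /delta.
  by move: a aZ; apply: gen5P => // _; rewrite !eqE /=; ring.
have zr y u : z · y = 0 -> ⟨z · u, y⟩ = 0.
  by move=> zy0; rewrite triple_swapr zy0 form0l oppr0.
have zt0 : z · t = 0 by apply: L2_abelian.
move: a b c; apply: gen5P => //; apply: gen5P => //; apply: gen5P => // _ _ _.
all: rewrite triformE /minor3 /delta !eqE /= ?z4 ?zt0 ?form0l ?(zr _ _ z4) ?(zr _ _ z5).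
all: rewrite ?z23 ?t23 ?t24 ?t25 ?t34 ?t35 ?t45 ?y234 ?y235 ?y245 ?y345; ring.
Qed.

End TypeB.

(** * Existence and uniqueness *)

Theorem proposition6p6 (F : fieldType) :
  exists L : saa F,
    [/\ nilpotent_10_4_3_typeB L,
        has_presentation L (P10_4_3 F)
      & forall M : saa F, nilpotent_10_4_3_typeB M -> saa_isomorphic M L].
Proof.
exists (model (P10_4_3 F)); split=> [||M].
- exact: model_nilpotent_typeB.
- exact: model_has_presentation.
move=> [[_ dimM] isoZ dimZ powM3 typeB].
have [e Se eT] := typeB_standard_basis dimM dimZ powM3 isoZ typeB.
apply: (standard_basis_isomorphic Se (model_standard _)) => a b c.
by rewrite eT mbasis_triple.
Qed.
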